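(* Let $H_x$ and $H_z$ be matrices over $\mathbb{F}_2$ of sizes $m_1\times n$ and $m_2\times n$ respectively with $H_xH_z^T=0$, and let $k$ be the dimension of the CSS code they define, so that $$k=\dim(\ker H_x/\operatorname{im}H_z^T)=\dim(\ker H_z/\operatorname{im}H_x^T)=n-\operatorname{rk}H_x-\operatorname{rk}H_z.$$ Let $\alpha\subset\mathbb{F}_2^n$ be any subspace, and put $$\ell_x=\dim\big(((\ker H_z\cap\alpha)+\operatorname{im}H_x^T)/\operatorname{im}H_x^T\big),\quad \ell_z=\dim\big(((\ker H_x\cap\alpha)+\operatorname{im}H_z^T)/\operatorname{im}H_z^T\big),$$ $$\ell'_x=\dim\big(((\ker H_z\cap\alpha^\bot)+\operatorname{im}H_x^T)/\operatorname{im}H_x^T\big),\quad \ell'_z=\dim\big(((\ker H_x\cap\alpha^\bot)+\operatorname{im}H_z^T)/\operatorname{im}H_z^T\big).$$ Then $$\ell_x+\ell'_z=\ell_z+\ell'_x=k.$$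
   Context: The orthogonal complement ${}^\bot$ in $\mathbb{F}_2^n$ is taken with respect to the form $(u,v)=\sum_{i=1}^n u_iv_i$. For an $m\times n$ matrix $H$ over $\mathbb{F}_2$, $\ker H=\{v\in\mathbb{F}_2^n\mid Hv=0\}$ and $\operatorname{im}H^T\subset\mathbb{F}_2^n$ is the row space of $H$. *)

(* Defs.v *)
From HB Require Import structures.
From mathcomp Require Import all_boot all_order all_algebra.
From mathcomp Require Import generic_quotient ring_quotient sesquilinear.

Set Implicit Arguments.
Unset Strict Implicit.
Unset Printing Implicit Defensive.

Import GRing.Theory.
Local Open Scope ring_scope.
Local Open Scope quotient_scope.

Section QuotientSpace.
Variables (K : fieldType) (vT : vectType K).
Implicit Types (U W : {vspace vT}) (v : vT).

(* The quotient vT / W is MathComp's quotient Z-module, whose elements are the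
   classes of u ~ v <-> u - v \in W; the library gives it neither a scaling nor
   a vectType structure, so both are added here. *)
Definition quotv W := Quotient.quot (pred_of_vspace W).

HB.instance Definition _ W := GRing.Zmodule.on (quotv W).
HB.instance Definition _ W := EqQuotient.on (quotv W).

Definition piv W : vT -> quotv W := \pi_(quotv W).

Lemma piv_eq W u v : (piv W u == piv W v) = (u - v \in W).
Proof. by rewrite -[LHS]Quotient.idealrBE. Qed.

Lemma pivD W : {morph piv W : u v / u + v}.
Proof. exact: Quotient.pi_add. Qed.

Lemma piv_repr W (q : quotv W) : piv W (repr q) = q.
Proof. exact: reprK. Qed.

Definition quotv_scale W (a : K) (q : quotv W) : quotv W :=
  piv W (a *: repr q).

Lemma pivZ W a v : piv W (a *: v) = quotv_scale a (piv W v).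
Proof.
apply/eqP; rewrite piv_eq -scalerBr rpredZ // -piv_eq piv_repr.
exact: eqxx.
Qed.

Fact quotv_scaleA W a b (q : quotv W) :
  quotv_scale a (quotv_scale b q) = quotv_scale (a * b) q.
Proof. by rewrite -[q]piv_repr -!pivZ scalerA. Qed.

Fact quotv_scale1 W : left_id 1 (@quotv_scale W).
Proof. by move=> q; rewrite -[q]piv_repr -!pivZ scale1r. Qed.

Fact quotv_scaleDr W : right_distributive (@quotv_scale W) +%R.
Proof.
by move=> a p q; rewrite -[p]piv_repr -[q]piv_repr -pivD -!pivZ -pivD scalerDr.
Qed.

Fact quotv_scaleDl W (q : quotv W) :
  {morph (@quotv_scale W)^~ q : a b / a + b}.
Proof. by move=> a b; rewrite -[q]piv_repr -!pivZ -pivD scalerDl. Qed.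

HB.instance Definition _ W := GRing.Zmodule_isLmodule.Build K (quotv W)
  (@quotv_scaleA W) (@quotv_scale1 W) (@quotv_scaleDr W) (@quotv_scaleDl W).

Fact piv_is_linear W : linear (piv W).
Proof. by move=> a u v; rewrite pivD pivZ. Qed.

HB.instance Definition _ W := GRing.isLinear.Build K vT (quotv W) _ (piv W)
  (@piv_is_linear W).

Lemma piv_eq0 W v : (piv W v == 0) = (v \in W).
Proof. by rewrite -(linear0 (piv W)) piv_eq subr0. Qed.

(* vT / W is isomorphic to the complement W^C of W. *)
Fact quotv_vect_iso W :
  Vector.axiom (\dim W^C) (quotv W).
Proof.
pose p := daddv_pi W^C%VS W; pose p' := daddv_pi W W^C%VS.
have capC : (W^C :&: W = 0)%VS by rewrite capvC capv_compl.
have pD v : p v + p' v = v.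
  by apply: daddv_pi_add; rewrite // addvC addv_complf memvf.
have p0 v : v \in W -> p v = 0.
  move=> Wv; apply: (addIr (p' v)); rewrite pD add0r.
  by rewrite /p' daddv_pi_id ?capv_compl.
pose f (q : quotv W) := \row_i coord (vbasis W^C) i (p (repr q)).
have fE v : f (piv W v) = \row_i coord (vbasis W^C) i (p v).
  apply/rowP=> i; rewrite !mxE; congr (coord _ _ _); apply/eqP.
  by rewrite -subr_eq0 -linearB /= p0 // -piv_eq piv_repr eqxx.
exists f.
  move=> a q r; rewrite -[q]piv_repr -[r]piv_repr -linearP /= !fE.
  by apply/rowP=> i; rewrite !mxE !linearP.
exists (fun r : 'rV_(\dim W^C) => piv W (\sum_i r 0 i *: (vbasis W^C)`_i)).
  move=> q; rewrite -{1}[q]piv_repr fE -[RHS]piv_repr; apply/eqP.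
  rewrite piv_eq -{2}[repr q]pD [X in X - _](_ : _ = p (repr q)).
    by rewrite opprD addNKr rpredN memv_pi.
  rewrite {2}(coord_vbasis (memv_pi W^C%VS W (repr q))).
  by apply: eq_bigr => i _; rewrite mxE.
move=> r; rewrite fE /p daddv_pi_id //.
  by apply/rowP=> i; rewrite mxE coord_sum_free ?(basis_free (vbasisP _)).
by apply: rpred_sum => i _; rewrite rpredZ ?vbasis_mem ?memt_nth.
Qed.

HB.instance Definition _ W := Lmodule_hasFinDim.Build K (quotv W)
  (@quotv_vect_iso W).

(* For W <= U this is U / W, as a subspace of vT / W. *)
Definition quot_space U W : {vspace quotv W} := (linfun (piv W) @: U)%VS.

End QuotientSpace.

Section CoordinateSpace.
Variable F : fieldType.

Definition kermat m n (H : 'M[F]_(m, n)) : {vspace 'cV[F]_n} :=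
  lker (linfun (mulmx H : 'cV[F]_n -> 'cV[F]_m)).

Definition immat m n (H : 'M[F]_(m, n)) : {vspace 'cV[F]_m} :=
  limg (linfun (mulmx H : 'cV[F]_n -> 'cV[F]_m)).

Lemma mem_kermat m n (H : 'M[F]_(m, n)) v : (v \in kermat H) = (H *m v == 0).
Proof. by rewrite memv_ker lfunE. Qed.

Lemma mem_immatP m n (H : 'M[F]_(m, n)) v :
  reflect (exists u, v = H *m u) (v \in immat H).
Proof.
apply: (iffP memv_imgP) => [[u _ ->]|[u ->]]; exists u; rewrite ?memvf //.
  by rewrite lfunE.
by rewrite lfunE.
Qed.

Definition dotv n (u v : 'cV[F]_n) : F := \sum_(i < n) u i 0 * v i 0.

Fact dotv_is_bilinear n : bilinear_for
  (GRing.Scale.Law.clone _ _ ( *%R ) _)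
  (GRing.Scale.Law.clone _ _ (idfun \; *%R ) _) (@dotv n).
Proof.
split=> [w|w] a u v /=; rewrite /dotv mulr_sumr -big_split /=;
  apply: eq_bigr => i _; rewrite !mxE.
  by rewrite mulrDl mulrA.
by rewrite mulrDr mulrCA.
Qed.

HB.instance Definition _ n := bilinear_isBilinear.Build F _ _ _
  (GRing.Scale.Law.clone _ _ ( *%R ) _)
  (GRing.Scale.Law.clone _ _ (idfun \; *%R ) _)
  (@dotv n) (@dotv_is_bilinear n).

Fact dotv_is_symmetric n (u v : 'cV[F]_n) :
  dotv u v = (-1) ^+ false * idfun (dotv v u).
Proof. by rewrite mul1r; apply: eq_bigr => i _; rewrite mulrC. Qed.

HB.instance Definition _ n := @isHermitianSesquilinear.Build F _ _ _
  (@dotv n) (@dotv_is_symmetric n).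

Definition orthc n (U : {vspace 'cV[F]_n}) : {vspace 'cV[F]_n} :=
  orthov (@dotv n) U.

Lemma mem_orthcP n (U : {vspace 'cV[F]_n}) u :
  reflect (forall v, v \in U -> dotv u v = 0) (u \in orthc U).
Proof. exact: mem_orthovP. Qed.

End CoordinateSpace.

(* Main.v *)
(** Since [ker Hx] and [ker Hz] are the orthogonals of [im Hx^T] and
    [im Hz^T], the modular law for [im Hx^T <= ker Hz] shows that
    [(ker Hz :&: alpha) + im Hx^T] and
    [(ker Hx :&: alpha^perp) + im Hz^T] are orthogonal complements of each
    other. Their dimensions thus add up to [n], and passing to the quotients
    subtracts [rk Hx + rk Hz]. *)

Require Import Defs.
From mathcomp Require Import all_boot all_order all_algebra.
From mathcomp Require Import sesquilinear.

Set Implicit Arguments.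
Unset Strict Implicit.
Unset Printing Implicit Defensive.

Import GRing.Theory.
Local Open Scope ring_scope.

(** Rank-nullity for [piv W] restricted to [U], whose kernel is [U :&: W = W]. The additive form
    avoids truncated subtraction. *)
Lemma dim_quot_space (K : fieldType) (vT : vectType K) (U W : {vspace vT}) :
  (W <= U)%VS -> (\dim (quot_space U W) + \dim W)%N = \dim U.
Proof.
move=> sWU; have kerW : lker (linfun (piv W)) = W.
  by apply/vspaceP => v; rewrite memv_ker lfunE /= piv_eq0.
have := limg_ker_dim (linfun (piv W)) U.
by rewrite kerW (capv_idPr sWU) addnC.
Qed.

Section ImageKernel.
Variable F : fieldType.

Lemma dim_kermat_immat m n (H : 'M[F]_(m, n)) :
  (\dim (kermat H) + \dim (immat H))%N = n.
Proof.
by rewrite -[kermat H]capfv limg_ker_dim dimvf /dim /= muln1.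
Qed.

Lemma immat_mulmx_row_free m p n (A : 'M[F]_(m, p)) (B : 'M[F]_(p, n)) :
  row_free B -> immat (A *m B) = immat A.
Proof.
case/row_freeP=> C BC; apply/vspaceP => v; apply/mem_immatP/mem_immatP.
  by case=> u ->; exists (B *m u); rewrite mulmxA.
by case=> u ->; exists (C *m u); rewrite -mulmxA (mulmxA B) BC mul1mx.
Qed.

Lemma kermat_row_full m n (H : 'M[F]_(m, n)) :
  row_full H -> kermat H = 0%VS.
Proof.
case/row_fullP=> C CH; apply/vspaceP => v; rewrite mem_kermat memv0.
apply/eqP/eqP => [Hv|->]; last by rewrite mulmx0.
by rewrite -[v]mul1mx -CH -mulmxA Hv mulmx0.
Qed.

(** In the rank factorization of [H], [row_base H] is surjective, so it leaves the image unchanged,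
    and [col_base H] is injective on a space of dimension [\rank H]. *)
Lemma dim_immat m n (H : 'M[F]_(m, n)) : \dim (immat H) = \rank H.
Proof.
rewrite -{1}(mulmx_base H) immat_mulmx_row_free ?row_base_free //.
have := dim_kermat_immat (col_base H).
by rewrite kermat_row_full ?col_base_full ?dimv0.
Qed.

(** The columns of [B] are a basis of [U]; this brings an arbitrary subspace within reach of
    [orthc_immat]. *)
Lemma immat_surj n (U : {vspace 'cV[F]_n}) :
  {B : 'M[F]_(n, \dim U) | U = immat B}.
Proof.
pose B := \matrix_(i < n, j < \dim U) (vbasis U)`_j i 0.
have BE u : B *m u = \sum_j u j 0 *: (vbasis U)`_j.
  apply/colP=> i; rewrite mxE summxE; apply: eq_bigr => j _.
  by rewrite !mxE mulrC.
exists B; apply/vspaceP => v; apply/idP/mem_immatP => [Uv|[u ->]].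
  exists (\col_j coord (vbasis U) j v); rewrite BE {1}(coord_vbasis Uv).
  by apply: eq_bigr => j _; rewrite mxE.
by rewrite BE rpred_sum // => j _; rewrite rpredZ ?vbasis_mem ?memt_nth.
Qed.

Lemma dotvE n (u v : 'cV[F]_n) : dotv u v = (v^T *m u) 0 0.
Proof. by rewrite mxE; apply: eq_bigr => i _; rewrite mxE mulrC. Qed.

Lemma orthc_immat m n (H : 'M[F]_(m, n)) : orthc (immat H) = kermat H^T.
Proof.
apply/vspaceP => v; rewrite mem_kermat; apply/mem_orthcP/eqP => [oHv|Hv w].
  (* Pairing [v] with the [i]-th column of [H] reads off coordinate [i] of [H^T *m v]. *)
  apply/colP=> i; rewrite [RHS]mxE -(oHv (H *m delta_mx i 0)).
    by rewrite dotvE trmx_mul trmx_delta -mulmxA -rowE [RHS]mxE.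
  by apply/mem_immatP; exists (delta_mx i 0).
by case/mem_immatP=> u ->; rewrite dotvE trmx_mul -mulmxA Hv mulmx0 mxE.
Qed.

(** Over a finite field [U] may meet [orthc U] nontrivially, so no direct sum is invoked: with
    [U = immat B], this is rank-nullity for [B^T] together with the equality of row and column
    rank. *)
Lemma dim_orthc n (U : {vspace 'cV[F]_n}) : (\dim U + \dim (orthc U))%N = n.
Proof.
have [B defU] := immat_surj U; rewrite {1}defU [in orthc _]defU.
rewrite orthc_immat dim_immat.
by rewrite -mxrank_tr -dim_immat addnC dim_kermat_immat.
Qed.

Lemma orthcS n (U V : {vspace 'cV[F]_n}) : (U <= V)%VS -> (orthc V <= orthc U)%VS.
Proof.
move/subvP=> sUV; apply/subvP => v /mem_orthcP oVv.
by apply/mem_orthcP => u /sUV/oVv.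
Qed.

(** Symmetry of the form gives one inclusion; [dim_orthc], applied to [U] and to [orthc U], gives
    equal dimensions. *)
Lemma orthcK n : involutive (@orthc F n).
Proof.
move=> U; apply/esym/eqP; rewrite eqEdim; apply/andP; split.
  by rewrite -orthov_sym.
by rewrite -(leq_add2r (\dim (orthc U))) [X in (_ <= X)%N]dim_orthc addnC dim_orthc.
Qed.

Lemma orthc_add n (U V : {vspace 'cV[F]_n}) :
  orthc (U + V) = (orthc U :&: orthc V)%VS.
Proof.
apply/eqP; rewrite eqEsubv subv_cap !orthcS ?addvSl ?addvSr //=.
by rewrite /orthc orthovD capvSl capvSr.
Qed.

Lemma orthc_cap n (U V : {vspace 'cV[F]_n}) :
  orthc (U :&: V) = (orthc U + orthc V)%VS.
Proof. by rewrite -[RHS]orthcK orthc_add !orthcK. Qed.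

Lemma dim_cap_orthc n (X Z A : {vspace 'cV[F]_n}) : (X <= orthc Z)%VS ->
  (\dim (quot_space ((orthc Z :&: A) + X) X)
   + \dim (quot_space ((orthc X :&: orthc A) + Z) Z) + \dim X + \dim Z)%N = n.
Proof.
move=> sXZ; rewrite -addnA addnACA dim_quot_space ?addvSr //.
rewrite dim_quot_space ?addvSr // vspace_modr //.
(* With [Z] written as a double orthogonal, the second space becomes
   [orthc (X + A) + orthc (orthc Z)], the orthogonal of [(X + A) :&: orthc Z], which is the first
   space. *)
by rewrite -orthc_add -[in X in (_ + \dim X)%N](orthcK Z) -orthc_cap capvC
  (addvC X) dim_orthc.
Qed.

End ImageKernel.

Theorem proposition4p2 (n m1 m2 : nat)
    (Hx : 'M['F_2]_(m1, n)) (Hz : 'M['F_2]_(m2, n))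
    (HxHz : Hx *m Hz^T = 0) (alpha : {vspace 'cV['F_2]_n}) :
  let k := \dim (quot_space (kermat Hx) (immat Hz^T)) in
  let lx := \dim (quot_space ((kermat Hz :&: alpha) + immat Hx^T)
                             (immat Hx^T)) in
  let lz := \dim (quot_space ((kermat Hx :&: alpha) + immat Hz^T)
                             (immat Hz^T)) in
  let lx' := \dim (quot_space ((kermat Hz :&: orthc alpha) + immat Hx^T)
                              (immat Hx^T)) in
  let lz' := \dim (quot_space ((kermat Hx :&: orthc alpha) + immat Hz^T)
                              (immat Hz^T)) in
  [/\ k = \dim (quot_space (kermat Hz) (immat Hx^T)),
      (k + \rank Hx + \rank Hz)%N = n,
      (lx + lz')%N = k
    & (lz + lx')%N = k].
Proof.
have kerE m (H : 'M['F_2]_(m, n)) : kermat H = orthc (immat H^T).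
  by rewrite orthc_immat trmxK.
have rkE m (H : 'M['F_2]_(m, n)) : \rank H = \dim (immat H^T).
  by rewrite dim_immat mxrank_tr.
have sZX : (immat Hz^T <= orthc (immat Hx^T))%VS.
  rewrite -kerE; apply/subvP => _ /mem_immatP[u ->].
  by rewrite mem_kermat mulmxA HxHz mul0mx.
(* From here only two subspaces with [Z <= orthc X] matter. *)
rewrite !kerE !rkE; move: (immat Hx^T) (immat Hz^T) sZX => X Z sZX /=.
have sXZ : (X <= orthc Z)%VS by rewrite [(_ <= _)%VS]orthov_sym.
have kZ : (\dim (quot_space (orthc X) Z) + \dim X + \dim Z)%N = n.
  by rewrite addnAC dim_quot_space // addnC dim_orthc.
have kX : (\dim (quot_space (orthc Z) X) + \dim X + \dim Z)%N = n.
  by rewrite dim_quot_space // addnC dim_orthc.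
(* Once [\dim X + \dim Z] is added, both sides of each remaining equation equal [n]. The last one is
   [dim_cap_orthc] with [X] and [Z] exchanged. *)
split=> //; apply: (@addIn (\dim X)); apply: (@addIn (\dim Z)).
- by rewrite kZ kX.
- by rewrite dim_cap_orthc.
- by rewrite addnAC dim_cap_orthc.
Qed.
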